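(* Let $(V,[-,-,-],b)$ be an indecomposable Lorentzian 3-Lie algebra. Then it is either one-dimensional, simple, or else there is a Witt basis $(u,v,x_a)$, with $u,v$ complementary null directions, such that the nonzero 3-brackets take the form $$[u,x_a,x_b]=f_{ab}{}^c x_c\qquad\text{and}\qquad [x_a,x_b,x_c]=-f_{abc}v,$$ where $[x_a,x_b]=f_{ab}{}^c x_c$ makes the span of the $(x_a)$ into a compact semisimple Lie algebra $\mathfrak{g}$ and $f_{abc}=b([x_a,x_b],x_c)$.
   Context: A (finite-dimensional real) 3-Lie algebra is a finite-dimensional real vector space with a totally skewsymmetric trilinear bracket satisfying the fundamental identity $[x,y,[z,s,t]]=[[x,y,z],s,t]+[z,[x,y,s],t]+[z,s,[x,y,t]]$; it is metric if it carries a nondegenerate symmetric bilinear form $b$ with $b([x,y,z],s)+b(z,[x,y,s])=0$, and Lorentzian if $b$ has exactly one negative eigenvalue (signature $(1,p)$). Indecomposable: not isomorphic to an orthogonal direct sum ($[V_1,V_2,\cdot]=0$, $b(V_1,V_2)=0$) of two metric 3-Lie algebras of positive dimension. Simple: not one-dimensional and with no ideals ($[I,V,V]\subset I$) other than $0$ and $V$. A Witt basis $(u,v,x_a)$ here means $b(u,u)=b(v,v)=0$, $b(u,v)=1$, and $(x_a)$ is a basis of the orthogonal complement of $\operatorname{span}(u,v)$, which is positive-definite; summation over repeated indices is understood. *)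

(* Defs.v *)
From HB Require Import structures.
From mathcomp Require Import all_boot all_order all_algebra.
From mathcomp Require Import reals.
Set Implicit Arguments. Unset Strict Implicit. Unset Printing Implicit Defensive.
Import Order.TTheory GRing.Theory Num.Theory.
Local Open Scope ring_scope.

(* The underlying vector space is 'rV[R]_n (any finite-dimensional real
   vector space is isomorphic to one of these).  The bilinear form b is
   given by its Gram matrix B in the standard basis. *)
Definition bf (R : realType) (n : nat) (B : 'M[R]_n) (x y : 'rV[R]_n) : R :=
  (x *m B *m y^T) 0 0.

Definition tbracket (R : realType) (n : nat) := 'rV[R]_n -> 'rV[R]_n -> 'rV[R]_n -> 'rV[R]_n.

Definition is_3Lie (R : realType) (n : nat) (br : tbracket R n) : Prop :=
  [/\ ((forall (a : R) x x' y z, br (a *: x + x') y z = a *: br x y z + br x' y z) /\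
      (forall (a : R) x y y' z, br x (a *: y + y') z = a *: br x y z + br x y' z) /\
      (forall (a : R) x y z z', br x y (a *: z + z') = a *: br x y z + br x y z')),
      (forall x y z, br x y z = - br y x z),
      (forall x y z, br x y z = - br x z y) &
      (forall x y z s t, br x y (br z s t) =
          br (br x y z) s t + br z (br x y s) t + br z s (br x y t))].

Definition is_metric_3Lie (R : realType) (n : nat) (br : tbracket R n)
    (B : 'M[R]_n) : Prop :=
  [/\ is_3Lie br, B^T = B, B \in unitmx &
      (forall x y z s, bf B (br x y z) s + bf B z (br x y s) = 0)].

(* Lorentzian: b has exactly one negative eigenvalue, counted with
   multiplicity (for a symmetric matrix, multiplicity = dim of eigenspace). *)
Definition lorentzian (R : realType) (n : nat) (B : 'M[R]_n) : Prop :=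
  exists l : R, [/\ l < 0, eigenvalue B l, \rank (eigenspace B l) = 1%N &
      forall m : R, m < 0 -> eigenvalue B m -> m = l].

(* Indecomposable: no decomposition V = V1 (+) V2 into nonzero subspaces
   (row spaces of matrices) with b(V1,V2) = 0, [V1,V2,.] = 0, and each Vi
   closed under the bracket (each Vi is then a metric 3-Lie algebra). *)
Definition indecomposable (R : realType) (n : nat) (br : tbracket R n)
    (B : 'M[R]_n) : Prop :=
  ~ exists V1 V2 : 'M[R]_n,
      [/\ (0 < \rank V1)%N /\ (0 < \rank V2)%N,
          (forall w : 'rV[R]_n, exists w1 w2,
              [/\ (w1 <= V1)%MS, (w2 <= V2)%MS & w = w1 + w2]),
          (forall w : 'rV[R]_n, (w <= V1)%MS -> (w <= V2)%MS -> w = 0) &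
          (forall x y, (x <= V1)%MS -> (y <= V2)%MS -> bf B x y = 0) /\
          (forall x y z, (x <= V1)%MS -> (y <= V2)%MS -> br x y z = 0) /\
          (forall x y z, (x <= V1)%MS -> (y <= V1)%MS -> (z <= V1)%MS ->
               (br x y z <= V1)%MS) /\
          (forall x y z, (x <= V2)%MS -> (y <= V2)%MS -> (z <= V2)%MS ->
               (br x y z <= V2)%MS)].

Definition is_ideal (R : realType) (n : nat) (br : tbracket R n) (I : 'M[R]_n) : Prop :=
  forall x y z, (x <= I)%MS -> (br x y z <= I)%MS.

Definition simple3 (R : realType) (n : nat) (br : tbracket R n) : Prop :=
  n <> 1%N /\
  forall I : 'M[R]_n, is_ideal br I -> \rank I = 0%N \/ \rank I = n.

(* Lie algebra on R^m given by structure constants f a b c = f_{ab}^c,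
   i.e. [e_a, e_b] = sum_c f_{ab}^c e_c. *)
Definition lie_constants (R : realType) (m : nat) (f : 'I_m -> 'I_m -> 'I_m -> R) : Prop :=
  (forall a b c, f a b c = - f b a c) /\
  (forall a b c e, \sum_d (f a b d * f d c e + f b c d * f d a e + f c a d * f d b e) = 0).

(* Killing form K(e_a, e_b) = tr(ad e_a o ad e_b); (ad e_a)_{dc} = f a c d *)
Definition killing (R : realType) (m : nat) (f : 'I_m -> 'I_m -> 'I_m -> R) (a b : 'I_m) : R :=
  \sum_c \sum_d f a d c * f b c d.

(* A real Lie algebra is compact semisimple iff its Killing form is
   negative definite. *)
Definition compact_semisimple (R : realType) (m : nat) (f : 'I_m -> 'I_m -> 'I_m -> R) : Prop :=
  lie_constants f /\
  forall w : 'I_m -> R, (exists a, w a != 0) ->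
    \sum_a \sum_b w a * w b * killing f a b < 0.

(* Main.v *)
Require Import Defs.
From HB Require Import structures.
From mathcomp Require Import all_boot all_order all_algebra.
From mathcomp Require Import reals complex boolp.
From mathcomp Require Import ring.
Import Order.TTheory GRing.Theory Num.Theory.
Local Open Scope ring_scope.

(** If [V] is not simple, take a proper ideal [I]. A nondegenerate ideal splits
off orthogonally, so the intersection of [I] with its orthogonal complement is
nonzero; it is totally isotropic, hence a null line [R v], and total skewness of
[b([x,y,z],w)] makes [v] central. Choose a null [u] with [b(u,v) = 1] and an
orthonormal basis [e_a] of the Euclidean complement [W] of [u, v].

The classification of Euclidean 3-Lie algebras is avoided with the Casimir
operator [C w = sum_ac [e_a,e_c,[e_a,e_c,w]]]. It is symmetric, kills [v], and
commutes with every [[p,q,-]], so that the image and kernel of its powers are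
ideals. On [v^perp / v] it is symmetric for a Euclidean form, whence [ker C^3]
and [im C^3] meet trivially and indecomposability gives [C^3 = 0]; then [C] itself
vanishes on [v^perp / v]. As [b(C w, w) = - sum_ac |[e_a,e_c,w]|^2], the bracket
of elements of [W] lies in [R v].

What remains is the Lie bracket [[u,-,-]] on [W]. It has trivial centre, since a
central vector of [W] would be central in [V] and split off, and [ad] is faithful
and skew for a Euclidean form, so the Killing form is negative definite. *)

(** * Diagonalizing the Gram matrix; the Lorentzian signature *)

Section Spectral.
Local Open Scope sesquilinear_scope.

(** A real symmetric matrix is Hermitian over [R[i]], hence unitarily diagonalizable with real
    eigenvalues. *)
Lemma bf_sum_spectral (R : realType) (n : nat) (B : 'M[R]_n) :
  B^T = B -> exists (P : 'M[R[i]]_n) (d : 'rV[R]_n),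
    [/\ P \is unitarymx,
        forall i, row i P *m map_mx (real_complex R) B
                    = real_complex R (d 0 i) *: row i P &
        forall x, bf B x x = \sum_i d 0 i *
          complex.Re (`|(map_mx (real_complex R) x *m P ^t* ) 0 i| ^+ 2)].
Proof.
move=> Bs; set Bc := map_mx (real_complex R) B.
have rB : Bc \is a realmx.
  by apply/mxOverP => i j; rewrite mxE; apply/complex_realP; exists (B i j).
have hB : Bc \is hermsymmx.
  apply: realsym_hermsym rB; apply/is_hermitianmxP.
  by rewrite expr0 scale1r map_mx_id // /Bc map_trmx Bs.
have rd := hermitian_spectral_diag_real hB.
have := hB; move=> /hermitian_normalmx/orthomx_spectralP.
have Pu := spectral_unitarymx Bc.
move: (spectral_diag Bc) (spectralmx Bc) rd Pu => d P rd Pu; rewrite invmx_unitary // => BE.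
have [dr dE] : exists dr : 'rV[R]_n, forall i, d 0 i = real_complex R (dr 0 i).
  exists (map_mx (@complex.Re R) d) => i.
  by rewrite mxE RRe_real //; exact: (mxOverP rd).
exists P, dr; split => //.
  move=> i; rewrite -row_mul BE !mulmxA (unitarymxP Pu) mul1mx.
  by rewrite -dE mul_diag_mx; apply/rowP => j; rewrite !mxE.
move=> x; set xc := map_mx _ x; apply: (@complexI R).
rewrite rmorph_sum /= /bf.
transitivity ((xc *m Bc *m xc ^t* ) 0 0).
  rewrite /xc /Bc -map_mxM; set y := x *m B; rewrite !mxE rmorph_sum /=.
  apply: eq_bigr => i _; rewrite rmorphM !mxE; congr (_ * _).
  by rewrite conj_Creal //; apply/complex_realP; exists (x 0 i).
have -> : xc *m Bc *m xc ^t* = xc *m P ^t* *m diag_mx d *m (xc *m P ^t* ) ^t*.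
  by rewrite {1}BE trmx_mul map_mxM map_trmx trmxCK !mulmxA.
move: (xc *m P ^t* ) => Y.
rewrite mxE; apply: eq_bigr => i _.
have ReE : real_complex R (complex.Re (`|Y 0 i| ^+ 2)) = `|Y 0 i| ^+ 2.
  by rewrite RRe_real // rpredX // normr_real.
rewrite rmorphM [X in _ = _ * X]ReE -[X in _ = X * _]dE.
by rewrite mul_mx_diag !mxE mulrAC normCK mulrC.
Qed.

(** The witness is an eigenvector for the negative eigenvalue: a vector orthogonal to it has no
    negative spectral component, and invertibility excludes the eigenvalue 0. *)
Lemma lorentzian_timelike (R : realType) (n : nat) (B : 'M[R]_n) :
  B^T = B -> B \in unitmx -> lorentzian B ->
  exists e, forall x, bf B x e = 0 -> x != 0 -> 0 < bf B x x.
Proof.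
move=> Bs Bu [l [l0 evl rk1 uniq]].
have /eigenvalueP [e eB e0] := evl.
exists e => x xe x0.
have [P [d [Pu PB q]]] := bf_sum_spectral _ _ _ Bs.
pose toC := real_complex R.
have rowP_neq0 i : row i P != 0.
  apply/eqP => rP; have := unitarymxP Pu; move/(congr1 (row i)).
  rewrite row_mul rP mul0mx row1 => /rowP/(_ i).
  by rewrite !mxE !eqxx => /eqP; rewrite eq_sym oner_eq0.
have d0 i : d 0 i != 0.
  apply: contraNneq (rowP_neq0 i) => di; have := PB i; rewrite di rmorph0 scale0r => PB0.
  have Bcu : map_mx toC B \in unitmx by rewrite map_unitmx.
  by rewrite -[row i P](mulmxK Bcu) PB0 mul0mx.
set Y := map_mx toC x *m P ^t* in q.
have Yneg i : d 0 i < 0 -> Y 0 i = 0.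
  move=> di.
  have ev : eigenvalue B (d 0 i).
    by rewrite -(eigenvalue_map toC); apply/eigenvalueP; exists (row i P).
  have dl := uniq _ di ev.
  (* The eigenspace of [l] is a line and stays one over [R[i]]. *)
  have sub : (row i P <= map_mx toC e)%MS.
    have s1 : (row i P <= map_mx toC (eigenspace B l))%MS.
      by rewrite map_eigenspace; apply/eigenspaceP; rewrite PB dl.
    apply: submx_trans s1 _; rewrite map_submx.
    have s2 : (e <= eigenspace B l)%MS by apply/eigenspaceP.
    by rewrite -(geq_leqif (mxrank_leqif_sup s2)) rk1 rank_rV e0.
  have [a aE] := sub_rVP sub.
  have -> : Y 0 i = (map_mx toC x *m (row i P) ^t* ) 0 0.
    by rewrite !mxE; apply: eq_bigr => j _; rewrite !mxE.
  rewrite aE linearZ map_mxZ -scalemxAr mxE.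
  suff -> : map_mx toC x *m (map_mx toC e)^t* = 0 by rewrite mxE mulr0.
  have -> : (map_mx toC e)^t* = map_mx toC e^T.
    apply/matrixP => j k; rewrite !mxE conj_Creal //.
    by apply/complex_realP; exists (e k j).
  rewrite -map_mxM -(map_mx0 toC); congr map_mx.
  apply/matrixP => j k; rewrite !ord1 [RHS]mxE.
  (* On the eigenvector [e], [b x e] is [l] times the standard dot product. *)
  have : l * (x *m e^T) 0 0 = 0.
    rewrite -xe /bf -mulmxA -[B in RHS]Bs -trmx_mul eB linearZ /= -scalemxAr.
    by rewrite [RHS]mxE.
  by move/eqP; rewrite mulf_eq0 (lt_eqF l0) => /eqP.
have tE i : 0 <= d 0 i * complex.Re (`|Y 0 i| ^+ 2) ?= iff (Y 0 i == 0).
  have ReE : real_complex R (complex.Re (`|Y 0 i| ^+ 2)) = `|Y 0 i| ^+ 2.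
    by rewrite RRe_real // rpredX // normr_real.
  have [di|di] := boolP (d 0 i < 0).
    by rewrite Yneg // normr0 expr0n /= mulr0 eqxx; split; rewrite ?lexx ?eqxx.
  have dp : 0 < d 0 i by rewrite lt_neqAle eq_sym d0 leNgt.
  split.
    by rewrite mulr_ge0 ?(ltW dp) // -ler0c ReE exprn_ge0.
  rewrite eq_sym mulf_eq0 (negbTE (d0 i)) /=.
  by rewrite -(inj_eq (@complexI R)) ReE rmorph0 expf_eq0 normr_eq0.
rewrite q lt_neqAle sumr_ge0 ?andbT; last by move=> i _; rewrite tE.
rewrite eq_sym psumr_eq0; last by move=> i _; rewrite tE.
apply: contra x0 => /allP allY.
have Y0 : Y = 0.
  apply/rowP => i; rewrite [RHS]mxE; apply/eqP.
  by rewrite -(tE i) eq_sym; have := allY i; rewrite mem_index_enum => /(_ isT).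
have : map_mx toC x = 0.
  have PP : P ^t* *m P = 1%:M by apply: mulmx1C; apply/unitarymxP.
  by rewrite -[LHS]mulmx1 -PP mulmxA -/Y Y0 mul0mx.
by move/eqP; rewrite map_mx_eq0.
Qed.
End Spectral.

(** * Linear maps given as plain functions *)

Section LinearMaps.
Context {R : pzRingType} {U V : lmodType R} {g : U -> V}.
Hypothesis lin_g : linear g.

Lemma lin0 : g 0 = 0.
Proof.
have := lin_g 1 0 0; rewrite scaler0 addr0 scale1r => /eqP.
by rewrite -subr_eq0 opprD addrA subrr add0r oppr_eq0 => /eqP.
Qed.

Lemma linD x y : g (x + y) = g x + g y.
Proof. by have := lin_g 1 x y; rewrite !scale1r. Qed.

Lemma linZ a x : g (a *: x) = a *: g x.
Proof. by have := lin_g a x 0; rewrite lin0 !addr0. Qed.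

Lemma linN x : g (- x) = - g x.
Proof. by rewrite -scaleN1r linZ scaleN1r. Qed.

Lemma lin_sum (I : Type) (r : seq I) (P : pred I) (F : I -> U) :
  g (\sum_(i <- r | P i) F i) = \sum_(i <- r | P i) g (F i).
Proof. by apply: (big_morph g linD lin0). Qed.
End LinearMaps.

Lemma linear_mxP {R : comNzRingType} {n : nat} {g : 'rV[R]_n -> 'rV[R]_n} :
  linear g -> exists M : 'M[R]_n, forall x, x *m M = g x.
Proof.
move=> lin_g; exists (\matrix_i g (delta_mx 0 i)) => x.
rewrite mulmx_sum_row {2}(row_sum_delta x) (lin_sum lin_g).
by apply: eq_bigr => i _; rewrite rowK (linZ lin_g).
Qed.

(** * Symmetric bilinear forms, orthogonal complements, orthonormal bases *)

Section SymmetricForm.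
Context {R : realType} {n : nat} {B : 'M[R]_n}.
Hypothesis symB : B^T = B.
Local Notation b := (bf B).

Lemma bfC x y : b x y = b y x.
Proof.
rewrite /bf -[RHS](mxE trmx_key (fun i j => (y *m B *m x^T) j i)).
by rewrite -/(trmx _) !trmx_mul trmxK symB mulmxA.
Qed.

Lemma bf_linl y : linear (fun x => b x y : R^o).
Proof. by move=> a x x'; rewrite /bf !mulmxDl -!scalemxAl !mxE. Qed.

Lemma bf_linr x : linear (fun y => b x y : R^o).
Proof. by move=> a y y'; rewrite !(bfC x) bf_linl. Qed.

Lemma bf0l y : b 0 y = 0. Proof. exact: (lin0 (bf_linl y)). Qed.
Lemma bf0r x : b x 0 = 0. Proof. exact: (lin0 (bf_linr x)). Qed.
Lemma bfDl x x' y : b (x + x') y = b x y + b x' y.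
Proof. exact: (linD (bf_linl y)). Qed.
Lemma bfDr x y y' : b x (y + y') = b x y + b x y'.
Proof. exact: (linD (bf_linr x)). Qed.
Lemma bfZl a x y : b (a *: x) y = a * b x y.
Proof. exact: (linZ (bf_linl y)). Qed.
Lemma bfZr a x y : b x (a *: y) = a * b x y.
Proof. exact: (linZ (bf_linr x)). Qed.
Lemma bfNl x y : b (- x) y = - b x y.
Proof. exact: (linN (bf_linl y)). Qed.
Lemma bfNr x y : b x (- y) = - b x y.
Proof. exact: (linN (bf_linr x)). Qed.
Lemma bf_suml (I : finType) (F : I -> 'rV[R]_n) y :
  b (\sum_i F i) y = \sum_i b (F i) y.
Proof. exact: (lin_sum (bf_linl y)). Qed.
Lemma bf_sumr (I : finType) (F : I -> 'rV[R]_n) x :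
  b x (\sum_i F i) = \sum_i b x (F i).
Proof. exact: (lin_sum (bf_linr x)). Qed.

Lemma bf_nondeg x : B \in unitmx -> (forall y, b x y = 0) -> x = 0.
Proof.
move=> Bu x0; suff : x *m B = 0 by move/(congr1 (mulmx^~ (invmx B))); rewrite mulmxK // mul0mx.
apply/rowP => i; rewrite [RHS]mxE -(x0 (delta_mx 0 i)) /bf trmx_delta.
by rewrite -colE [RHS]mxE.
Qed.

Definition perp (I : 'M[R]_n) : 'M[R]_n := kermx (B *m I^T).

Lemma perpP (I : 'M[R]_n) (x : 'rV[R]_n) :
  reflect (forall y : 'rV[R]_n, (y <= I)%MS -> b x y = 0) (x <= perp I)%MS.
Proof.
rewrite /perp; apply: (iffP sub_kermxP) => [xI y /submxP [D ->]|xI].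
  by rewrite /bf trmx_mul mulmxA -(mulmxA x) xI mul0mx mxE.
apply/rowP => i; rewrite [RHS]mxE -(xI _ (row_sub i I)) /bf mulmxA.
by rewrite !mxE; apply: eq_bigr => k _; rewrite !mxE.
Qed.

(** Gram-Schmidt: an orthonormal family in [S] that does not span [S] can be extended, and freeness
    bounds its size by [n]. *)
Lemma orthonormal_basis (S : 'rV[R]_n -> Prop) :
  (forall a x y, S x -> S y -> S (a *: x + y)) -> S 0 ->
  (forall x, S x -> x != 0 -> 0 < b x x) ->
  exists m (x : 'I_m -> 'rV[R]_n),
    [/\ forall a, S (x a), forall a c, b (x a) (x c) = (a == c)%:R &
        forall w, S w -> w = \sum_a b w (x a) *: x a].
Proof.
move=> Slin S0 Spos.
pose ON m (X : 'M[R]_(m, n)) := (forall a, S (row a X)) /\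
  (forall a c, b (row a X) (row c X) = (a == c)%:R).
have bnd m X : ON m X -> (m <= n)%N.
  move=> [_ X1]; suff /eqP <- : row_free X by exact: rank_leq_col.
  apply/row_freeP; exists (B *m X^T); apply/matrixP => a c.
  rewrite mulmxA [RHS]mxE -X1 /bf !mxE; apply: eq_bigr => k _.
  rewrite !mxE; congr (_ * _); apply: eq_bigr => j _; by rewrite mxE.
(* Induction on [k], a bound on the number of extensions still possible. Both cases build the
   extended family; for [k = 0] it contradicts [bnd]. *)
suff: forall k m X, ON m X -> (n <= m + k)%N -> exists m (x : 'I_m -> 'rV[R]_n),
    [/\ forall a, S (x a), forall a c, b (x a) (x c) = (a == c)%:R &
        forall w, S w -> w = \sum_a b w (x a) *: x a].
  move=> /(_ n 0%N 0); apply; last by [].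
  by split; case.
elim=> [|k IH] m X ONX nm.
all: have [SX X1] := ONX.
all: have [full|/existsNP [w /not_implyP [Sw wN]]] :=
  pselect (forall w, S w -> w = \sum_a b w (row a X) *: row a X);
  first by exists m, (fun a => row a X).
all: pose w' := w - \sum_a b w (row a X) *: row a X.
all: have w'0 : w' != 0 by rewrite subr_eq0; apply/eqP.
all: have Ssum : forall (r : seq 'I_m) (F : 'I_m -> R), S (\sum_(a <- r) F a *: row a X)
  by move=> r F; elim: r => [|a r IHr]; rewrite ?big_nil ?big_cons //; apply: Slin.
all: have Sw' : S w' by rewrite /w' addrC -scaleN1r; apply: Slin.
all: have w'X : forall a, b w' (row a X) = 0
  by move=> a; rewrite /w' bfDl bfNl bf_suml (bigD1 a) //= bfZl X1 eqxx mulr1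
     big1 ?addr0 ?subrr // => c ca; rewrite bfZl X1 (negbTE ca) mulr0.
all: have w'p := Spos _ Sw' w'0.
all: pose t := (Num.sqrt (b w' w'))^-1.
all: have t1 : t * (t * b w' w') = 1
  by rewrite mulrA -expr2 exprVn sqr_sqrtr ?ltW // mulVf ?gt_eqF.
all: have ON' : ON (m + 1)%N (col_mx X (t *: w')).
1,3: split=> [a|a c]; first (case: (split_ordP a) => j ->;
   rewrite ?rowKu ?rowKd ?row_id //; by rewrite -[_ *: _]addr0; apply: Slin);
 case: (split_ordP a) => j ->; case: (split_ordP c) => i ->; rewrite ?rowKu ?rowKd ?row_id
  ?X1 ?bfZl ?bfZr ?(bfC (row _ X)) ?w'X ?mulr0 ?eq_lshift ?eq_lrshift ?eq_rlshift ?eq_rshift //;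
  by rewrite !ord1 eqxx.
- by have := bnd _ _ ON'; rewrite addn0 in nm; rewrite addn1 leqNgt ltnS nm.
- by apply: (IH _ _ ON'); rewrite addn1 addSnnS.
Qed.

End SymmetricForm.

(** * Metric 3-Lie algebras and their ideals *)

Section Metric3Lie.
Context {R : realType} {n : nat}.
Context {br : 'rV[R]_n -> 'rV[R]_n -> 'rV[R]_n -> 'rV[R]_n} {B : 'M[R]_n}.
Hypothesis metric : is_metric_3Lie br B.
Local Notation b := (bf B).

Lemma metric_sym : B^T = B. Proof. by case: metric. Qed.
Let symB := metric_sym.

Lemma br_lin1 y z : linear (fun x => br x y z).
Proof. by case: metric => -[[h _] _ _ _] _ _ _ a x x'; exact: h. Qed.
Lemma br_lin2 x z : linear (fun y => br x y z).
Proof. by case: metric => -[[_ [h _]] _ _ _] _ _ _ a y y'; exact: h. Qed.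
Lemma br_lin3 x y : linear (br x y).
Proof. by case: metric => -[[_ [_ h]] _ _ _] _ _ _ a z z'; exact: h. Qed.

Lemma br_swap12 x y z : br x y z = - br y x z.
Proof. by case: metric => -[_ h _ _] _ _ _; exact: h. Qed.
Lemma br_swap23 x y z : br x y z = - br x z y.
Proof. by case: metric => -[_ _ h _] _ _ _; exact: h. Qed.
Lemma br_rot x y z : br x y z = br y z x.
Proof. by rewrite br_swap12 br_swap23 opprK. Qed.
Lemma br_fund x y z s t : br x y (br z s t) =
  br (br x y z) s t + br z (br x y s) t + br z s (br x y t).
Proof. by case: metric => -[_ _ _ h] _ _ _; exact: h. Qed.
Lemma br_skew x y z s : b (br x y z) s = - b (br x y s) z.
Proof.
by case: metric => _ _ _ /(_ x y z s) /eqP; rewrite addr_eq0 (bfC symB z) => /eqP.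
Qed.

Lemma br_xxy x y : br x x y = 0.
Proof.
have /eqP := br_swap12 x x y.
by rewrite -addr_eq0 -mulr2n -scaler_nat scaler_eq0 pnatr_eq0 => /eqP.
Qed.
Lemma br_xyx x y : br x y x = 0.
Proof. by rewrite br_swap23 br_xxy oppr0. Qed.
Lemma br_xyy x y : br x y y = 0.
Proof. by rewrite br_rot br_xxy. Qed.

Lemma br_orth x y z : b (br x y z) z = 0.
Proof.
have /eqP := br_skew x y z z.
by rewrite -addr_eq0 -mulr2n mulrn_eq0 => /eqP.
Qed.

Lemma ideal_perp {I : 'M[R]_n} : is_ideal br I -> is_ideal br (perp (B := B) I).
Proof.
move=> idI x y z /perpP xI; apply/perpP => w wI.
rewrite -br_rot -br_rot br_skew (bfC symB) xI ?oppr0 //.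
by rewrite br_rot br_rot; apply: idI.
Qed.

(* The form restricted to [I] is nondegenerate, so [I] and its orthogonal
   complement are complementary ideals, and the product of complementary
   ideals lies in their intersection. *)
Lemma nondegenerate_ideal (I : 'M[R]_n) :
  indecomposable br B -> is_ideal br I ->
  (forall x : 'rV[R]_n, (x <= I)%MS -> (forall y : 'rV[R]_n, (y <= I)%MS -> b x y = 0) -> x = 0) ->
  \rank I = 0%N \/ \rank I = n.
Proof.
move=> indec idI ndI; have idP := ideal_perp idI; set J := perp I in idP.
have capIJ : (I :&: J = 0)%MS.
  apply/eqP/rowV0P => w; rewrite sub_capmx => /andP [wI /perpP wJ].
  exact: ndI.
have Bu : B \in unitmx by case: metric.
have rJ : \rank J = (n - \rank I)%N.
  rewrite /J /perp mxrank_ker -mxrank_tr trmx_mul trmxK mxrankMfree //.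
  by rewrite row_free_unit unitmx_tr.
case: (posnP (\rank I)) => [|rI0]; [by left|right].
case: (posnP (\rank J)) => [/eqP|rJ0].
  by rewrite rJ subn_eq0 => nI; apply/eqP; rewrite eqn_leq nI rank_leq_col.
case: indec; exists I, J; split => //.
- move=> w; have full : row_full (I + J)%MS.
    by rewrite /row_full (mxrank_disjoint_sum capIJ) rJ subnKC ?rank_leq_col.
  have /sub_addsmxP [[p q] /= ->] : (w <= I + J)%MS by rewrite submx_full.
  by exists (p *m I), (q *m J); rewrite !submxMl.
- move=> w wI wJ; apply/eqP; rewrite -submx0 -capIJ.
  by rewrite sub_capmx wI.
split; first by move=> x y xI /perpP yJ; rewrite (bfC symB) yJ.
split=> [x y z xI yJ|]; last by split=> x y z xX _ _; [apply: idI | apply: idP].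
apply/eqP; rewrite -submx0 -capIJ sub_capmx idI //=.
by rewrite br_rot; apply: idP.
Qed.

(** Otherwise the line through [x] would be a nondegenerate ideal of rank 1. *)
Lemma spacelike_noncentral (x : 'rV[R]_n) :
  indecomposable br B -> n <> 1%N -> b x x != 0 -> ~ forall y z, br x y z = 0.
Proof.
move=> indec n1 xx cx.
have x0 : x != 0 by apply: contraNneq xx => ->; rewrite bf0l.
have row0 : forall w : 'rV[R]_n, (w <= <<x>>)%MS -> exists k, w = k *: x.
  by move=> w; rewrite genmxE => /sub_rVP.
case: (nondegenerate_ideal <<x>>%MS indec) => [y z w /row0 [k ->]|y /row0 [k ->] ky||].
- by rewrite (linZ (br_lin1 _ _)) cx scaler0 sub0mx.
- have := ky x; rewrite genmxE => /(_ (submx_refl x)) /eqP.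
  by rewrite bfZl mulf_eq0 (negbTE xx) orbF => /eqP ->; rewrite scale0r.
- by rewrite genmxE => /eqP; rewrite mxrank_eq0 (negbTE x0).
by rewrite genmxE rank_rV x0 => /esym.
Qed.

(** * The Casimir operator *)

Section Casimir.
Context {v u : 'rV[R]_n} {m : nat} {e : 'I_m -> 'rV[R]_n}.
Hypothesis v_central : forall y z, br v y z = 0.
Hypothesis e_basis : forall y, b y v = 0 ->
  y = b y u *: v + \sum_a b y (e a) *: e a.

Lemma br_perp_central x y z : b (br x y z) v = 0.
Proof. by rewrite br_skew -br_rot v_central bf0l // oppr0. Qed.

(* The Casimir operator of the bracket: a full basis of the space contributes
   no further terms because [v] is central. *)
Definition casimir w := \sum_a \sum_c br (e a) (e c) (br (e a) (e c) w).

Lemma casimir_linear : linear casimir.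
Proof.
move=> k x y; rewrite /casimir scaler_sumr -big_split; apply: eq_bigr => a _.
rewrite scaler_sumr -big_split; apply: eq_bigr => c _.
by rewrite !br_lin3.
Qed.

(** Each summand is the square of a skew operator, so the two signs cancel. *)
Lemma casimir_sym x y : b (casimir x) y = b x (casimir y).
Proof.
rewrite /casimir bf_suml bf_sumr //; apply: eq_bigr => a _.
rewrite bf_suml bf_sumr //; apply: eq_bigr => c _.
by rewrite (bfC symB x) br_skew [RHS]br_skew; congr (- _); apply: bfC.
Qed.

Lemma casimir_quad x :
  b (casimir x) x = - \sum_a \sum_c b (br (e a) (e c) x) (br (e a) (e c) x).
Proof.
rewrite /casimir bf_suml -sumrN; apply: eq_bigr => a _.
by rewrite bf_suml -sumrN; apply: eq_bigr => c _; rewrite br_skew.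
Qed.

Lemma casimir_central : casimir v = 0.
Proof.
rewrite /casimir big1 // => a _; rewrite big1 // => c _.
by rewrite -(br_rot v) v_central (lin0 (br_lin3 _ _)).
Qed.

Lemma casimir_perp x : b (casimir x) v = 0.
Proof. by rewrite casimir_sym casimir_central bf0r. Qed.

(* The derivation [br p q] is skew, so the tensor [\sum_a e a (x) e a] is
   annihilated by it modulo [v]. *)
Lemma skew_contraction p q (E : 'rV[R]_n -> 'rV[R]_n -> 'rV[R]_n) :
  (forall z, linear (E ^~ z)) -> (forall y, linear (E y)) ->
  (forall z, E v z = 0) -> (forall y, E y v = 0) ->
  \sum_a (E (br p q (e a)) (e a) + E (e a) (br p q (e a))) = 0.
Proof.
move=> lin1 lin2 E1 E2.
pose D a d := b (br p q (e a)) (e d).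
have LE a : br p q (e a) = b (br p q (e a)) u *: v + \sum_d D a d *: e d.
  by apply: e_basis; apply: br_perp_central.
have E1E a : E (br p q (e a)) (e a) = \sum_d D a d *: E (e d) (e a).
  rewrite LE (linD (lin1 _)) (linZ (lin1 _)) E1 scaler0 add0r (lin_sum (lin1 _)).
  by apply: eq_bigr => d _; rewrite (linZ (lin1 _)).
have E2E a : E (e a) (br p q (e a)) = \sum_d D a d *: E (e a) (e d).
  rewrite LE (linD (lin2 _)) (linZ (lin2 _)) E2 scaler0 add0r (lin_sum (lin2 _)).
  by apply: eq_bigr => d _; rewrite (linZ (lin2 _)).
rewrite big_split /=; under eq_bigr do rewrite E1E.
under [X in _ + X]eq_bigr do rewrite E2E.
rewrite exchange_big -big_split /= big1 // => a _.
rewrite -big_split /= big1 // => d _.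
by rewrite /D br_skew scaleNr addNr.
Qed.

(** The fundamental identity makes [br p q] a derivation; the terms where it hits a basis vector
    cancel by [skew_contraction]. *)
Lemma casimir_comm p q w : br p q (casimir w) = casimir (br p q w).
Proof.
(* [G a c] collects the terms where [br p q] hits [e a]. Those where it hits [e c] form [G c a],
   since swapping the first two arguments in both nested brackets costs no sign. *)
pose G a c := br (br p q (e a)) (e c) (br (e a) (e c) w)
            + br (e a) (e c) (br (br p q (e a)) (e c) w).
have G0 : \sum_a \sum_c G a c = 0.
  rewrite exchange_big big1 // => c _.
  apply: (skew_contraction p q (fun y z => br y (e c) (br z (e c) w))).
  - by move=> z k y y'; rewrite br_lin1.
  - by move=> y k z z'; rewrite br_lin1 br_lin3.
  - by move=> z; rewrite v_central.
  - by move=> y; rewrite v_central (lin0 (br_lin3 _ _)).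
have split3 a c : br p q (br (e a) (e c) (br (e a) (e c) w)) =
    br (e a) (e c) (br (e a) (e c) (br p q w)) + (G a c + G c a).
  rewrite br_fund (br_fund p q (e a) (e c) w) !(linD (br_lin3 _ _)).
  have -> : G c a = br (e a) (br p q (e c)) (br (e a) (e c) w)
                  + br (e a) (e c) (br (e a) (br p q (e c)) w).
    rewrite /G (br_swap12 (br p q (e c)) (e a)) (br_swap12 (e c) (e a)).
    rewrite (br_swap12 (e c) (e a)) (br_swap12 (br p q (e c)) (e a)).
    by rewrite !(linN (br_lin3 _ _)) !opprK.
  by rewrite addrA [RHS]addrC addrACA.
rewrite /casimir (lin_sum (br_lin3 _ _)).
under eq_bigr => a _ do [rewrite (lin_sum (br_lin3 _ _));
  under eq_bigr do rewrite split3; rewrite big_split].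
rewrite big_split /= [X in _ + X](_ : _ = 0) ?addr0 //.
under eq_bigr do rewrite big_split.
by rewrite big_split /= [X in _ + X]exchange_big /= G0 addr0.
Qed.

Hypothesis v0 : v != 0.
Hypothesis perp_ge0 : forall y, b y v = 0 -> 0 <= b y y.
Hypothesis perp_null : forall y, b y v = 0 -> b y y = 0 -> exists k, y = k *: v.

Lemma null_perp {y z} : b y v = 0 -> b y y = 0 -> b z v = 0 -> b y z = 0.
Proof.
move=> yv yy zv; have [k ->] := perp_null _ yv yy.
by rewrite bfZl (bfC symB) zv mulr0.
Qed.

(** With [C] the Casimir operator, symmetry makes [C^2 y] null, hence orthogonal to [y]; so [C y] is
    null as well and lies on the line of [v], which [C] kills. *)
Lemma casimir_nilpotent y : b y v = 0 ->
  casimir (casimir (casimir y)) = 0 -> casimir (casimir y) = 0.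
Proof.
move=> yv y3; have C1 := casimir_perp y; have C2 := casimir_perp (casimir y).
have C2n : b (casimir (casimir y)) (casimir (casimir y)) = 0.
  by rewrite -casimir_sym y3 bf0l.
have C1n : b (casimir y) (casimir y) = 0.
  by rewrite -casimir_sym; apply: null_perp.
have [k ->] := perp_null _ C1 C1n.
by rewrite (linZ casimir_linear) casimir_central scaler0.
Qed.

(* By Fitting's lemma for the Casimir operator, which commutes with all inner
   derivations, an indecomposable algebra forces it to be nilpotent. *)
Lemma perp_bracket_null : indecomposable br B ->
  forall a c y, b y v = 0 -> exists k, br (e a) (e c) y = k *: v.
Proof.
move=> indec a c y yv.
have [M ME] := linear_mxP casimir_linear.
have KE x : x *m (M *m M *m M) = casimir (casimir (casimir x)).
  by rewrite !mulmxA !ME.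
(* The image of the cube is an ideal, and it is not everything because [v] is killed. If [C^3 D] is
   orthogonal to it, then [C^6 D = 0], and [casimir_nilpotent] lowers the exponent from 6 to 3. It
   stops there because it applies to vectors orthogonal to [v], such as [C D]. *)
have K0 x : casimir (casimir (casimir x)) = 0.
  rewrite -KE; case: (nondegenerate_ideal (M *m M *m M) indec).
  - move=> p q z /submxP [D ->]; rewrite KE br_rot.
    by rewrite !casimir_comm -KE submxMl.
  - move=> p /submxP [D ->] pK; rewrite KE.
    have C6 : casimir (casimir (casimir (casimir (casimir (casimir D))))) = 0.
      apply: (@bf_nondeg _ _ B) => [|z]; first by case: metric.
      by rewrite 3!casimir_sym -!KE pK ?submxMl.
    apply: casimir_nilpotent (casimir_perp _) _.
    apply: casimir_nilpotent (casimir_perp _) _.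
    exact: casimir_nilpotent (casimir_perp _) C6.
  - by move/eqP; rewrite mxrank_eq0 => /eqP ->; rewrite mulmx0.
  move=> /eqP rK; have := row_free_inj (A := M *m M *m M) rK.
  move=> /(_ 1%N v 0); rewrite (KE v) casimir_central !(lin0 casimir_linear) mul0mx.
  move=> /(_ erefl) v00.
  by move: v0; rewrite v00 eqxx.
(* Now [C y] is null, so [b (C y) y = 0]; by [casimir_quad] a sum of nonnegative norms vanishes,
   hence each term does. *)
have Cn : b (casimir y) (casimir y) = 0.
  by rewrite -casimir_sym casimir_nilpotent // bf0l.
have := null_perp (casimir_perp y) Cn yv.
rewrite casimir_quad => /eqP; rewrite oppr_eq0.
have ge0 i j : 0 <= b (br (e i) (e j) y) (br (e i) (e j) y).
  by apply: perp_ge0; apply: br_perp_central.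
rewrite psumr_eq0 => [/allP/(_ a)|i _]; last by apply: sumr_ge0 => j _.
rewrite mem_index_enum psumr_eq0 => [/(_ isT)/allP/(_ c)|j _ //].
rewrite mem_index_enum => /(_ isT) /eqP.
by apply: perp_null; apply: br_perp_central.
Qed.
End Casimir.
End Metric3Lie.

(** * Null vectors of a Lorentzian form *)

Section NullVector.
Context {R : realType} {n : nat} {B : 'M[R]_n} {t v : 'rV[R]_n}.
Hypothesis symB : B^T = B.
Local Notation b := (bf B).
Hypothesis timelike : forall x, b x t = 0 -> x != 0 -> 0 < b x x.
Hypothesis v0 : v != 0.
Hypothesis vv : b v v = 0.

Let vt : b v t != 0.
Proof. by apply/eqP => vt0; have := timelike _ vt0 v0; rewrite vv ltxx. Qed.

(** A shift along [v] into the positive-definite complement of [t], scaled to avoid a division. For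
    [y] orthogonal to [v] it only multiplies the norm by a positive factor. *)
Let shear y := b v t *: y - b y t *: v.

Let shear_perp y : b (shear y) t = 0.
Proof. by rewrite /shear bfDl bfNl !bfZl mulrC subrr. Qed.

Let shear_norm y : b y v = 0 -> b (shear y) (shear y) = b v t ^+ 2 * b y y.
Proof.
move=> yv; rewrite /shear !(bfDl, bfNl, bfZl, bfDr symB, bfNr symB, bfZr symB).
by rewrite (bfC symB v y) yv vv; ring.
Qed.

Lemma null_perp_ge0 y : b y v = 0 -> 0 <= b y y.
Proof.
move=> yv; rewrite -(pmulr_rge0 _ (x := b v t ^+ 2)) ?exprn_even_gt0 //.
rewrite -shear_norm //; have [-> |s0] := eqVneq (shear y) 0; first by rewrite bf0l.
by apply: ltW; apply: timelike s0; apply: shear_perp.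
Qed.

Lemma null_perp_null y : b y v = 0 -> b y y = 0 -> exists k, y = k *: v.
Proof.
move=> yv yy; have [/eqP|s0] := eqVneq (shear y) 0.
  rewrite subr_eq0 => /eqP yE; exists ((b v t)^-1 * b y t).
  by rewrite -scalerA -yE scalerA mulVf // scale1r.
by have := timelike _ (shear_perp y) s0; rewrite shear_norm // yy mulr0 ltxx.
Qed.

Lemma complementary_null : B \in unitmx -> exists u, b u u = 0 /\ b u v = 1.
Proof.
move=> Bu; have [y vy] : exists y, b v y != 0.
  apply: contrapT => /forallNP vN; move: v0; rewrite (@bf_nondeg _ _ B v) ?eqxx //.
  by move=> y; apply/eqP; apply: contrapT => vy; apply: (vN y); apply/negP.
have [u uv] : exists u, b u v = 1.
  by exists ((b v y)^-1 *: y); rewrite bfZl (bfC symB y) mulVf.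
(* As [v] is null, this correction keeps the pairing with [v] and cancels the norm of [u]. *)
exists (u - (b u u / 2) *: v).
rewrite !(bfDl, bfNl, bfZl, bfDr symB, bfNr symB, bfZr symB) (bfC symB v u) uv vv.
by split; field.
Qed.
End NullVector.

(** * Dimension count and sign of the Killing form *)

Lemma witt_dim {R : realType} {n : nat} {B : 'M[R]_n} {u v : 'rV[R]_n} {m : nat}
    {e : 'I_m -> 'rV[R]_n} :
  B^T = B -> bf B u u = 0 -> bf B v v = 0 -> bf B u v = 1 ->
  (forall a, bf B (e a) u = 0 /\ bf B (e a) v = 0) ->
  (forall a c, bf B (e a) (e c) = (a == c)%:R) ->
  (forall y, y = bf B y v *: u + bf B y u *: v + \sum_a bf B y (e a) *: e a) ->
  n = (m + 2)%N.
Proof.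
move=> symB uu vv uv eperp ee span.
pose X := \matrix_a e a.
pose M := col_mx X (col_mx u v).
(* The dual basis of [M]: the form pairs [u] with [v], so these two trade places. *)
pose N := col_mx X (col_mx v u).
have dot p q (P : 'M[R]_(p, n)) (Q : 'M[R]_(q, n)) i j :
    (P *m B *m Q^T) i j = bf B (row i P) (row j Q).
  rewrite /bf !mxE; apply: eq_bigr => k _; rewrite !mxE; congr (_ * _).
  by apply: eq_bigr => l _; rewrite !mxE.
have MN : M *m (B *m N^T) = 1%:M.
  apply/matrixP => i j; rewrite mulmxA dot /M /N mxE.
  case: (split_ordP i) => a ->; case: (split_ordP j) => c ->;
    rewrite ?rowKu ?rowKd ?eq_lshift ?eq_lrshift ?eq_rlshift ?eq_rshift /X ?rowK ?ee //.
  - case: (split_ordP c) => d ->; rewrite ?rowKu ?rowKd row_id;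
      by have [? ?] := eperp a.
  - case: (split_ordP a) => d ->; rewrite ?rowKu ?rowKd row_id bfC //;
      by have [? ?] := eperp c.
  case: (split_ordP a) => d ->; case: (split_ordP c) => f ->;
    by rewrite ?rowKu ?rowKd !row_id ?eq_lshift ?eq_lrshift ?eq_rlshift ?eq_rshift
      ?ord1 ?eqxx // bfC.
have /eqP freeM : row_free M by apply/row_freeP; exists (B *m N^T).
suff /eqP : row_full M by rewrite freeM => <-.
rewrite -sub1mx; apply/row_subP => i; move: (row i _) => y.
rewrite (span y) /M -addsmxE; apply: addmx_sub.
  apply: submx_trans (addsmxSr _ _); rewrite -addsmxE.
  rewrite addmx_sub // scalemx_sub //.
  + exact: addsmxSl.
  + exact: addsmxSr.
apply: submx_trans (addsmxSl _ _); apply: summx_sub => a _; apply: scalemx_sub.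
by rewrite -[e a](rowK (fun a => e a)) row_sub.
Qed.

(** For a skew matrix, the trace of the square is minus the sum of the squared entries; faithfulness
    provides a nonzero entry. *)
Lemma witt_killing_negative {R : realType} {m : nat} (f : 'I_m -> 'I_m -> 'I_m -> R) :
  (forall a c d, f a c d = - f a d c) ->
  (forall w : 'I_m -> R, (exists a, w a != 0) -> exists c d, \sum_a w a * f a d c != 0) ->
  forall w : 'I_m -> R, (exists a, w a != 0) ->
    \sum_a \sum_c w a * w c * killing f a c < 0.
Proof.
move=> fskew faithful w w0.
have -> : \sum_a \sum_c w a * w c * killing f a c =
    - \sum_c \sum_d (\sum_a w a * f a d c) ^+ 2.
  transitivity (\sum_a \sum_i \sum_c \sum_d (- ((w a * f a d c) * (w i * f i d c)))).
    apply: eq_bigr => a _; apply: eq_bigr => i _; rewrite /killing mulr_sumr.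
    apply: eq_bigr => c _; rewrite mulr_sumr; apply: eq_bigr => d _.
    by rewrite (fskew i c d); ring.
  under eq_bigr do rewrite exchange_big; rewrite exchange_big -sumrN /=.
  apply: eq_bigr => c _; under eq_bigr do rewrite exchange_big.
  rewrite exchange_big -sumrN /=; apply: eq_bigr => d _.
  rewrite expr2 mulr_suml -sumrN; apply: eq_bigr => a _.
  by rewrite mulr_sumr -sumrN.
have [c [d cd0]] := faithful w w0.
rewrite oppr_lt0 lt_neqAle eq_sym; apply/andP; split; last first.
  by apply: sumr_ge0 => i _; apply: sumr_ge0 => j _; apply: sqr_ge0.
rewrite psumr_eq0 => [|i _]; last by apply: sumr_ge0 => j _; apply: sqr_ge0.
apply/allPn; exists c; rewrite ?mem_index_enum //=.
rewrite psumr_eq0 => [|j _]; last exact: sqr_ge0.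
by apply/allPn; exists d; rewrite ?mem_index_enum //= sqrf_eq0.
Qed.

(** * The non-simple case: central null vector and structure constants *)

Section Witt.
Context {R : realType} {n : nat}.
Context {br : 'rV[R]_n -> 'rV[R]_n -> 'rV[R]_n -> 'rV[R]_n} {B : 'M[R]_n}.
Hypothesis metric : is_metric_3Lie br B.
Hypothesis indec : indecomposable br B.
Hypothesis n1 : n <> 1%N.
Local Notation b := (bf B).
Let symB := metric_sym metric.

(** A proper nonzero ideal is degenerate, so it meets its complement in some [v != 0]. Brackets of
    [v] stay in both ideals, hence are null and orthogonal to [v]. *)
Lemma isotropic_ideal : ~ simple3 br -> exists v : 'rV[R]_n,
  [/\ v != 0, b v v = 0 & forall y z, b (br v y z) v = 0 /\ b (br v y z) (br v y z) = 0].
Proof.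
move=> ns; have [I [idI I0 In]] : exists I : 'M[R]_n,
    [/\ is_ideal br I, \rank I <> 0%N & \rank I <> n].
  apply: contrapT => NI; apply: ns; split=> // I idI.
  apply: contrapT => /not_orP [I0 In]; apply: NI; by exists I.
apply: contrapT => Nv; have [] := nondegenerate_ideal metric I indec idI; [|by []|by []].
move=> x xI xJ; apply: contrapT => /eqP x0; apply: Nv; exists x; split => //.
  exact: xJ.
have xP : (x <= perp (B := B) I)%MS by apply/perpP.
move=> y z; have /perpP brP := ideal_perp metric idI _ y z xP.
by split; apply: brP => //; apply: idI.
Qed.

(** Pairing with [u] reads off the coefficient of [v]. It vanishes for [br v y u] by skewness, and
    then for every [br v y z] by exchanging [z] and [u]. *)
Lemma null_ideal_central {v u : 'rV[R]_n} : b u v = 1 -> b v v = 0 ->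
  (forall y z, exists k, br v y z = k *: v) -> forall y z, br v y z = 0.
Proof.
move=> uv vv lam.
have F0 y z : b (br v y z) u = 0.
  have [k vyu] := lam y u.
  have yu0 : k = 0.
    by rewrite -[k]mulr1 -uv (bfC symB u) -bfZl -vyu br_orth.
  by rewrite (br_skew metric) vyu yu0 scale0r bf0l oppr0.
move=> y z; have [k vyz] := lam y z; have := F0 y z.
by rewrite vyz bfZl (bfC symB) uv mulr1 => ->; rewrite scale0r.
Qed.

Section Basis.
Context {v u : 'rV[R]_n} {m : nat} {e : 'I_m -> 'rV[R]_n}.
Hypothesis uv : b u v = 1.
Hypothesis ee : forall a c, b (e a) (e c) = (a == c)%:R.
Hypothesis span : forall y, y = b y v *: u + b y u *: v + \sum_a b y (e a) *: e a.
Hypothesis v_central : forall y z, br v y z = 0.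
Hypothesis brackets_null : forall a c d, exists k, br (e a) (e c) (e d) = k *: v.

(** Lowered and raised last index agree because [e] is orthonormal. *)
Definition structure_constants a c d := b (br u (e a) (e c)) (e d).
Local Notation f := structure_constants.

Lemma bf_basis_sum (w : 'I_m -> R) c : b (\sum_a w a *: e a) (e c) = w c.
Proof.
rewrite bf_suml (bigD1 c) //= bfZl ee eqxx mulr1 big1 ?addr0 // => a ac.
by rewrite bfZl ee (negbTE ac) mulr0.
Qed.

Lemma br_u_perp x y : b (br u x y) u = 0 /\ b (br u x y) v = 0.
Proof.
by rewrite (br_perp_central metric v_central) (br_rot metric) br_orth.
Qed.

Lemma br_u x y : br u x y = \sum_c b (br u x y) (e c) *: e c.
Proof.
have [pu pv] := br_u_perp x y.
by rewrite [LHS]span pu pv !scale0r !add0r.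
Qed.

(** The coefficient of [v] is the pairing with [u], which total skewness moves into the bracket. *)
Lemma br_basis a c d : br (e a) (e c) (e d) = - f a c d *: v.
Proof.
have [k kE] := brackets_null a c d; rewrite kE; congr (_ *: _).
rewrite -[k]mulr1 -uv (bfC symB u) -bfZl -kE (br_skew metric).
by rewrite -(br_rot metric u).
Qed.

Lemma br_v_right x y : br x y v = 0.
Proof. by rewrite -(br_rot metric v). Qed.

Lemma central_of_basis x :
  (forall a, br x u (e a) = 0) -> (forall a c, br x (e a) (e c) = 0) ->
  forall y z, br x y z = 0.
Proof.
move=> xu xe; have xez a z : br x (e a) z = 0.
  rewrite (span z) !(linD (br_lin3 metric _ _)) !(linZ (br_lin3 metric _ _)).
  rewrite br_v_right (br_swap23 metric x _ u) xu oppr0 !scaler0 !add0r.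
  rewrite (lin_sum (br_lin3 metric _ _)) big1 // => c _.
  by rewrite (linZ (br_lin3 metric _ _)) xe scaler0.
have xuz z : br x u z = 0.
  rewrite (span z) !(linD (br_lin3 metric _ _)) !(linZ (br_lin3 metric _ _)).
  rewrite br_v_right (br_xyy metric) !scaler0 !add0r.
  rewrite (lin_sum (br_lin3 metric _ _)) big1 // => c _.
  by rewrite (linZ (br_lin3 metric _ _)) xu scaler0.
move=> y z; rewrite (span y) !(linD (br_lin2 metric _ _)) !(linZ (br_lin2 metric _ _)).
rewrite xuz (br_swap23 metric x v) br_v_right oppr0 !scaler0 !add0r.
rewrite (lin_sum (br_lin2 metric _ _)) big1 // => c _.
by rewrite (linZ (br_lin2 metric _ _)) xez scaler0.
Qed.

Lemma structure_skew a c d : f a c d = - f a d c.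
Proof. by rewrite /structure_constants (br_skew metric). Qed.

(** Jacobi is the fundamental identity with [u] in both the outer and the inner bracket; the term
    that brackets [u] with itself drops out. *)
Lemma structure_lie : lie_constants f.
Proof.
split=> [a c d|a c d e']; first by rewrite /structure_constants (br_swap23 metric) bfNl.
have E x y z : \sum_i f x y i * f i z e' = b (br u (br u (e x) (e y)) (e z)) (e e').
  rewrite [in RHS](br_u (e x) (e y)) (lin_sum (br_lin2 metric _ _)) bf_suml; apply: eq_bigr => i _.
  by rewrite (linZ (br_lin2 metric _ _)) bfZl.
rewrite !big_split /= !E -!bfDl.
rewrite (br_swap23 metric u _ (e d)) (br_fund metric u (e d)).
rewrite (br_xyx metric) (lin0 (br_lin1 metric _ _)) add0r.
rewrite (br_swap23 metric u (br u (e c) (e d)) (e a)) (br_swap23 metric u (e c) (e d)).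
rewrite (linN (br_lin3 metric _ _)) opprK.
rewrite opprD subrK addNr.
exact: bf0l.
Qed.

(** If [ad x = 0], then [br_basis] kills the brackets of [x] with the [e a] too, so [x] is central
    of nonzero norm, against [spacelike_noncentral]. *)
Lemma structure_faithful (w : 'I_m -> R) : (exists a, w a != 0) ->
  exists c d, \sum_a w a * f a d c != 0.
Proof.
move=> [i wi]; apply: contrapT => N.
pose x := \sum_a w a *: e a.
have fx d c : b (br u x (e d)) (e c) = 0.
  have -> : b (br u x (e d)) (e c) = \sum_a w a * f a d c.
    rewrite /x (lin_sum (br_lin2 metric _ _)) bf_suml; apply: eq_bigr => a _.
    by rewrite (linZ (br_lin2 metric _ _)) bfZl.
  by apply/eqP; apply: contrapT => /negP ne; apply: N; exists c, d.
have ux d : br u x (e d) = 0 by rewrite br_u big1 // => c _; rewrite fx scale0r.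
have xx : b x x != 0.
  rewrite {2}/x bf_sumr // psumr_eq0 => [|a _].
    apply/allPn; exists i; rewrite ?mem_index_enum //=.
    by rewrite bfZr // bf_basis_sum mulf_neq0.
  by rewrite bfZr // bf_basis_sum -expr2 sqr_ge0.
apply: (spacelike_noncentral metric x indec n1 xx); apply: central_of_basis.
  by move=> a; rewrite (br_swap12 metric) ux oppr0.
move=> a c; rewrite /x (lin_sum (br_lin1 metric _ _)).
under eq_bigr do rewrite (linZ (br_lin1 metric _ _)) br_basis scalerA mulrN.
rewrite -scaler_suml sumrN.
have := fx a c; rewrite /x (lin_sum (br_lin2 metric _ _)) bf_suml => fx0.
rewrite [X in - X](_ : _ = 0) ?oppr0 ?scale0r // -[RHS]fx0; apply: eq_bigr => d _.
by rewrite (linZ (br_lin2 metric _ _)) bfZl.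
Qed.

Lemma structure_compact : compact_semisimple f.
Proof.
split; first exact: structure_lie.
apply: witt_killing_negative; [exact: structure_skew | exact: structure_faithful].
Qed.
End Basis.
End Witt.

Theorem mainTheorem4 (R : realType) (n : nat)
    (br : 'rV[R]_n -> 'rV[R]_n -> 'rV[R]_n -> 'rV[R]_n) (B : 'M[R]_n) :
  is_metric_3Lie br B -> lorentzian B -> indecomposable br B ->
  [\/ n = 1%N,
      simple3 br |
      exists (u v : 'rV[R]_n) (x : 'I_(n - 2) -> 'rV[R]_n)
             (f : 'I_(n - 2) -> 'I_(n - 2) -> 'I_(n - 2) -> R),
        (* (u, v, x_a) is a Witt basis *)
        (bf B u u = 0 /\ bf B v v = 0 /\ bf B u v = 1) /\
        (forall a, bf B u (x a) = 0 /\ bf B v (x a) = 0) /\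
        (forall c : 'I_(n - 2) -> R, \sum_a c a *: x a = 0 -> forall a, c a = 0) /\
        (forall w, bf B u w = 0 -> bf B v w = 0 ->
           exists c : 'I_(n - 2) -> R, w = \sum_a c a *: x a) /\
        (forall c : 'I_(n - 2) -> R, (exists a, c a != 0) ->
           0 < bf B (\sum_a c a *: x a) (\sum_a c a *: x a)) /\
        (* the nonzero brackets (all others between basis vectors vanish) *)
        (forall w, br u v w = 0) /\
        (forall a b, br v (x a) (x b) = 0) /\
        (forall a b, br u (x a) (x b) = \sum_c f a b c *: x c) /\
        (forall a b c, br (x a) (x b) (x c) =
           - (bf B (\sum_d f a b d *: x d) (x c)) *: v) /\
        (* [x_a, x_b] = f_ab^c x_c defines a compact semisimple Lie algebra *)
        compact_semisimple f].
Proof.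
move=> metric lor indec; have symB := metric_sym metric.
have Bu : B \in unitmx by case: metric.
have [n1|n1] := pselect (n = 1%N); first by constructor 1.
have [simp|nsimp] := pselect (simple3 br); [by constructor 2|constructor 3].
have [t tl] := lorentzian_timelike _ _ _ symB Bu lor.
have [v [v0 vv vbr]] := isotropic_ideal metric indec n1 nsimp.
have perp_ge0 := null_perp_ge0 symB tl v0 vv.
have perp_null := null_perp_null symB tl v0 vv.
have [u [uu uv]] := complementary_null symB v0 vv Bu.
have v_central : forall y z, br v y z = 0.
  apply: (null_ideal_central metric uv vv) => y z; have [h1 h2] := vbr y z.
  exact: perp_null.
have [m [e [eS ee eW]]] : exists m (e : 'I_m -> 'rV[R]_n),
    [/\ forall a, bf B (e a) u = 0 /\ bf B (e a) v = 0,
        forall a c, bf B (e a) (e c) = (a == c)%:R &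
        forall w, bf B w u = 0 /\ bf B w v = 0 ->
          w = \sum_a bf B w (e a) *: e a].
  apply: (orthonormal_basis symB (fun w => bf B w u = 0 /\ bf B w v = 0)).
  - move=> a x y [xu xv] [yu yv].
    by rewrite !bfDl !bfZl xu xv yu yv mulr0 addr0.
  - by rewrite !bf0l.
  (* A null vector here is a multiple of [v], and orthogonality to [u] makes the multiple zero. *)
  move=> x [xu xv] x0; rewrite lt_neqAle perp_ge0 // andbT.
  apply: contra x0 => /eqP/esym xx; have [k xE] := perp_null x xv xx.
  by move: xu; rewrite xE bfZl (bfC symB) uv mulr1 => ->; rewrite scale0r.
have eu a : bf B (e a) u = 0 by have [] := eS a.
have ev a : bf B (e a) v = 0 by have [] := eS a.
have span y : y = bf B y v *: u + bf B y u *: v + \sum_a bf B y (e a) *: e a.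
  pose w := y - (bf B y v *: u + bf B y u *: v).
  have wu : bf B w u = 0.
    by rewrite /w bfDl bfNl bfDl !bfZl uu (bfC symB v u) uv; ring.
  have wv : bf B w v = 0.
    by rewrite /w bfDl bfNl bfDl !bfZl vv uv; ring.
  have we a : bf B w (e a) = bf B y (e a).
    by rewrite /w bfDl bfNl bfDl !bfZl !(bfC symB _ (e a)) eu ev; ring.
  have := eW w (conj wu wv); under eq_bigr do rewrite we.
  by move=> <-; rewrite /w addrC subrK.
have perp_span y : bf B y v = 0 ->
    y = bf B y u *: v + \sum_a bf B y (e a) *: e a.
  by move=> yv; rewrite {1}(span y) yv scale0r add0r.
have null := perp_bracket_null metric v_central perp_span v0 perp_ge0 perp_null indec.
have brackets_null a c d : exists k, br (e a) (e c) (e d) = k *: v by apply: null.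
(* Since [n = m + 2], the truncated subtraction is exact, and the family can be reindexed by
   ['I_(n - 2)]. *)
have mE : m = (n - 2)%N by rewrite (witt_dim symB uu vv uv eS ee span) addnK.
case: _ / mE in e eS ee eW eu ev span perp_span null brackets_null *.
exists u, v, e, (structure_constants (br := br) (B := B) (u := u) (e := e)).
have indep := bf_basis_sum ee.
split; first by [].
split; first by move=> a; rewrite !(bfC symB _ (e a)).
split; first by move=> c c0 a; rewrite -(indep c a) c0 bf0l.
split.
  move=> w uw vw; exists (fun a => bf B w (e a)); apply: eW.
  by rewrite (bfC symB w) uw (bfC symB w).
split.
  move=> c [a ca]; rewrite bf_sumr // lt_neqAle.
  have E i : bf B (\sum_j c j *: e j) (c i *: e i) = c i ^+ 2.
    by rewrite bfZr // indep expr2.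
  under eq_bigr do rewrite E; rewrite sumr_ge0 ?andbT; last by move=> i _; apply: sqr_ge0.
  rewrite eq_sym psumr_eq0 => [|i _]; last exact: sqr_ge0.
  by apply/allPn; exists a; rewrite ?mem_index_enum //= sqrf_eq0.
split; first by move=> w; rewrite (br_swap12 metric) v_central oppr0.
split; first by move=> a c; apply: v_central.
split; first by move=> a c; apply: (br_u metric span v_central).
split; last exact: (structure_compact metric indec n1 uv ee span v_central brackets_null).
by move=> a c d; rewrite indep; apply: (br_basis metric uv brackets_null).
Qed.
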